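(* Let $m\ge n$, $0\le r<n$, $A^1,\dots,A^l\in\mathbb{R}^{m\times n}$, $b\in\mathbb{R}^l$, and $X\in\mathcal{L}\cap\mathcal{M}(r)$ with $s=\operatorname{rank}(X)$ and SVD $X=U\Sigma V^\top$ as in the context. (i) If $s=r$ and Assumption 1 holds at $X$, then $\mathrm{N}^F_{\mathcal{L}\cap\mathcal{M}(r)}(X)=\mathrm{N}_{\mathcal{L}}(X)+\mathrm{N}^F_{\mathcal{M}(r)}(X)$. (ii) If $s<r$ and Assumption 2 holds at $X$, then $\mathrm{N}^F_{\mathcal{L}\cap\mathcal{M}(r)}(X)=\mathrm{N}_{\mathcal{L}}(X)+\mathrm{N}^F_{\mathcal{M}(r)}(X)=\mathrm{N}_{\mathcal{L}}(X)$.
   Context: $\langle X,Y\rangle=\sum_{i,j}X_{ij}Y_{ij}$. $\mathcal{A}(X)=(\langle A^1,X\rangle,\dots,\langle A^l,X\rangle)^\top$, $\mathcal{L}=\{X:\mathcal{A}(X)=b\}$, $\mathrm{N}_{\mathcal{L}}(X)=\{\sum_i y_iA^i:y\in\mathbb{R}^l\}$, $\mathcal{M}(r)=\{X:\operatorname{rank}(X)\le r\}$. For closed $\Omega$ and $X\in\Omega$: $\mathrm{T}^B_\Omega(X)$ is the set of $\Xi$ with $X^k\in\Omega$, $X^k\to X$, $t_k\downarrow0$, $(X^k-X)/t_k\to\Xi$; $\mathrm{N}^F_\Omega(X)=\{Y:\langle Y,\Xi\rangle\le0\ \forall\Xi\in\mathrm{T}^B_\Omega(X)\}$. SVD convention: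 $X=U\Sigma V^\top$, $U$, $V$ orthogonal of sizes $m$, $n$, $\Sigma$ with diagonal $\sigma_1\ge\dots\ge\sigma_s>0$ followed by zeros, $\Gamma=\{1,\dots,s\}$, $\Gamma_m^\perp=\{s+1,\dots,m\}$, $\Gamma_n^\perp=\{s+1,\dots,n\}$, $U_J,V_J$ column submatrices indexed by $J$. Define $T^i_X=\begin{bmatrix}U_\Gamma^\top A^iV_\Gamma & U_\Gamma^\top A^iV_{\Gamma_n^\perp}\\ U_{\Gamma_m^\perp}^\top A^iV_\Gamma & O\end{bmatrix}$ and $R^i_X=U^\top A^iV_\Gamma$, $i=1,\dots,l$. Assumption 1 at $X$: $T^1_X,\dots,T^l_X$ linearly independent. Assumption 2 at $X$: $R^1_X,\dots,R^l_X$ linearly independent. *)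

(* Defs.v *)
From HB Require Import structures.
From mathcomp Require Import all_boot all_order all_algebra.
From mathcomp Require Import all_classical all_reals all_analysis.
Set Implicit Arguments. Unset Strict Implicit. Unset Printing Implicit Defensive.
Import Order.TTheory GRing.Theory Num.Theory.
Import numFieldNormedType.Exports.
Local Open Scope classical_set_scope.
Local Open Scope ring_scope.

Section Defs.
Variable R : realType.

Definition frob {m n : nat} (X Y : 'M[R]_(m, n)) : R :=
  \sum_(i < m) \sum_(j < n) X i j * Y i j.

Definition affine_set {m n l : nat} (A : 'I_l -> 'M[R]_(m, n)) (b : 'I_l -> R)
  : set 'M[R]_(m, n) := [set X | forall i, frob (A i) X = b i].

Definition normal_affine {m n l : nat} (A : 'I_l -> 'M[R]_(m, n))
  : set 'M[R]_(m, n) := [set Y | exists y : 'I_l -> R, Y = \sum_(i < l) y i *: A i].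

Definition low_rank (m n r : nat) : set 'M[R]_(m, n) :=
  [set X | (\rank X <= r)%N].

Definition bouligand_tangent {m n : nat} (Om : set 'M[R]_(m, n)) (X : 'M[R]_(m, n))
  : set 'M[R]_(m, n) :=
  [set Xi | exists (Xs : nat -> 'M[R]_(m, n)) (t : nat -> R),
     (forall k, Om (Xs k)) /\ Xs @ \oo --> X /\
     (forall k, 0 < t k) /\ {homo t : a b / (a <= b)%N >-> b <= a} /\
     t @ \oo --> (0 : R) /\
     (fun k => (t k)^-1 *: (Xs k - X)) @ \oo --> Xi].

Definition frechet_normal {m n : nat} (Om : set 'M[R]_(m, n)) (X : 'M[R]_(m, n))
  : set 'M[R]_(m, n) :=
  [set Y | forall Xi, bouligand_tangent Om X Xi -> frob Y Xi <= 0].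

Definition mx_minkowski_sum {m n : nat} (S1 S2 : set 'M[R]_(m, n)) : set 'M[R]_(m, n) :=
  [set Z | exists Y1 Y2, S1 Y1 /\ S2 Y2 /\ Z = Y1 + Y2].

Definition lin_indep {p q l : nat} (F : 'I_l -> 'M[R]_(p, q)) : Prop :=
  forall c : 'I_l -> R, \sum_(i < l) c i *: F i = 0 -> forall i, c i = 0.

Definition orthogonal_mx {k : nat} (U : 'M[R]_k) : Prop := U^T *m U = 1%:M.

Definition svd_diag {m n : nat} (s : nat) (S : 'M[R]_(m, n)) : Prop :=
  [/\ forall (i : 'I_m) (j : 'I_n), (i : nat) <> j -> S i j = 0,
      forall (i : 'I_m) (j : 'I_n), (i : nat) = j -> (i < s)%N -> 0 < S i j,
      forall (i : 'I_m) (j : 'I_n), (i : nat) = j -> (s <= i)%N -> S i j = 0 &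
      forall (i i' : 'I_m) (j j' : 'I_n), (i : nat) = j -> (i' : nat) = j' ->
        (i <= i')%N -> (i' < s)%N -> S i' j' <= S i j].

Definition is_svd {m n : nat} (X : 'M[R]_(m, n)) (s : nat)
  (U : 'M[R]_m) (S : 'M[R]_(m, n)) (V : 'M[R]_n) : Prop :=
  [/\ orthogonal_mx U, orthogonal_mx V, svd_diag s S & X = U *m S *m V^T].

(* T^i_X = [[U_G^T A V_G, U_G^T A V_Gperp]; [U_Gperp^T A V_G, O]] :
   the m x n matrix U^T A V with its lower-right (m-s) x (n-s) block zeroed. *)
Definition T_mx {m n : nat} (s : nat) (U : 'M[R]_m) (V : 'M[R]_n)
  (A : 'M[R]_(m, n)) : 'M[R]_(m, n) :=
  \matrix_(i < m, j < n)
     (if ((i < s)%N || (j < s)%N) then (U^T *m A *m V) i j else 0).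

(* R^i_X = U^T A V_G, an m x s matrix (V_G = first s columns of V) *)
Definition R_mx {m n : nat} (s : nat) (Hs : (s <= n)%N) (U : 'M[R]_m)
  (V : 'M[R]_n) (A : 'M[R]_(m, n)) : 'M[R]_(m, s) :=
  \matrix_(i < m, j < s) (U^T *m A *m V) i (widen_ord Hs j).

End Defs.
Arguments low_rank {R} m n r.

(* Main.v *)
Require Import Defs.
From HB Require Import structures.
From mathcomp Require Import all_boot all_order all_algebra.
From mathcomp Require Import all_classical all_reals all_analysis.
Import Order.TTheory GRing.Theory Num.Theory.
Import numFieldNormedType.Exports.
Local Open Scope classical_set_scope.
Local Open Scope ring_scope.

(* Only the inclusion of the normal cone of the intersection in the sum needs
   the assumptions.  Write [X = L0 R0] with [L1 L0 = 1], [R0 R1 = 1], and put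
   [P = 1 - L0 L1].

   If [rank X = r], the curves [(L0 + t P H R1) (R0 + t L1 H)] have rank at most
   [r] and velocity [T H = L0 L1 H + P H R1 R0], and [T] maps onto the tangent
   space of the rank variety.  Assumption 1 says that [H |-> <A_i, T H>] is onto,
   so there are [B_j] with [<A_i, T B_j>] the identity matrix.  For [T H] in the
   kernel of the constraints, correcting [H] by [sum_j w_j B_j] reduces
   feasibility of the curve to [w = t phi(w)] with [phi] quadratic, solved by
   the Banach fixed point theorem with [w = O(t)].  Hence every such [T H] is
   tangent to the intersection, a normal [Y] annihilates it, and
   [Y - sum_i <Y, T B_i> A_i] annihilates the range of [T], i.e. it is normal to
   the rank variety.

   If [rank X < r], no fixed point is needed: for [K] of rank one, the line
   [X + t (C R0 + K)] stays in the rank variety, and Assumption 2 provides a [C]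
   making it feasible, so the value of [Y] on every rank-one [K] is determined
   by the constraints. *)

(** Makes matrices a complete normed space, the setting of the Banach fixed point theorem. *)
HB.instance Definition _ (R : realType) (m n : nat) := Complete.on 'M[R]_(m, n).

(** * The Frobenius inner product and dual families *)

Section Frobenius.
Set Implicit Arguments. Unset Strict Implicit.
Variable R : realType.
Implicit Types m n p l : nat.

Lemma frobC m n (A B : 'M[R]_(m, n)) : frob A B = frob B A.
Proof. by apply: eq_bigr => i _; apply: eq_bigr => j _; rewrite mulrC. Qed.

Lemma frob_trace m n (A B : 'M[R]_(m, n)) : frob A B = \tr (A^T *m B).
Proof.
rewrite /frob exchange_big; apply: eq_bigr => j _ /=; rewrite mxE.
by apply: eq_bigr => i _; rewrite mxE.
Qed.

Lemma frobDr m n (A B C : 'M[R]_(m, n)) : frob A (B + C) = frob A B + frob A C.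
Proof. by rewrite !frob_trace mulmxDr mxtraceD. Qed.

Lemma frobZr m n (A B : 'M[R]_(m, n)) a : frob A (a *: B) = a * frob A B.
Proof. by rewrite !frob_trace -scalemxAr mxtraceZ. Qed.

Lemma frob0r m n (A : 'M[R]_(m, n)) : frob A 0 = 0.
Proof. by rewrite frob_trace mulmx0 mxtrace0. Qed.

Lemma frobNr m n (A B : 'M[R]_(m, n)) : frob A (- B) = - frob A B.
Proof. by rewrite -scaleN1r frobZr mulN1r. Qed.

Lemma frobBr m n (A B C : 'M[R]_(m, n)) : frob A (B - C) = frob A B - frob A C.
Proof. by rewrite frobDr frobNr. Qed.

Lemma frob_sumr m n (I : finType) (A : 'M[R]_(m, n)) (B : I -> 'M[R]_(m, n)) :
  frob A (\sum_i B i) = \sum_i frob A (B i).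
Proof. exact: (big_morph (frob A) (frobDr A) (frob0r A)). Qed.

Lemma frobDl m n (A B C : 'M[R]_(m, n)) : frob (A + B) C = frob A C + frob B C.
Proof. by rewrite frobC frobDr !(frobC C). Qed.

Lemma frobBl m n (A B C : 'M[R]_(m, n)) : frob (A - B) C = frob A C - frob B C.
Proof. by rewrite frobC frobBr !(frobC C). Qed.

Lemma frob_lincombl m n l (c : 'I_l -> R) (A : 'I_l -> 'M[R]_(m, n)) B :
  frob (\sum_i c i *: A i) B = \sum_i c i * frob (A i) B.
Proof.
by rewrite frobC frob_sumr; apply: eq_bigr => i _; rewrite frobZr frobC.
Qed.

Lemma frob_lincombr m n l (c : 'I_l -> R) A (B : 'I_l -> 'M[R]_(m, n)) :
  frob A (\sum_i c i *: B i) = \sum_i c i * frob A (B i).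
Proof. by rewrite frob_sumr; apply: eq_bigr => i _; rewrite frobZr. Qed.

Lemma frob_mulmxl m n p (A : 'M[R]_(m, n)) (L : 'M[R]_(m, p)) (G : 'M[R]_(p, n)) :
  frob A (L *m G) = frob (L^T *m A) G.
Proof. by rewrite !frob_trace trmx_mul trmxK mulmxA. Qed.

Lemma frob_mulmxr m n p (A : 'M[R]_(m, n)) (C : 'M[R]_(m, p)) (Q : 'M[R]_(p, n)) :
  frob A (C *m Q) = frob (A *m Q^T) C.
Proof. by rewrite !frob_trace trmx_mul trmxK mulmxA mxtrace_mulC mulmxA. Qed.

Lemma frob_delta m n (A : 'M[R]_(m, n)) i j : frob A (delta_mx i j) = A i j.
Proof.
rewrite /frob (bigD1 i) //= (bigD1 j) //= !mxE !eqxx mulr1.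
rewrite !big1 ?addr0 // => [k ki|k kj]; last by rewrite mxE (negbTE kj) andbF mulr0.
by rewrite big1 // => q _; rewrite mxE (negbTE ki) mulr0.
Qed.

Lemma frob_eq0 m n (A : 'M[R]_(m, n)) : (forall B, frob A B = 0) -> A = 0.
Proof. by move=> A0; apply/matrixP => i j; rewrite -frob_delta A0 mxE. Qed.

(** By hypothesis the rows of [M], the coordinates of the functionals [H |-> frob (A i) (F H)], are
    independent; the columns of a right inverse of [M] are the wanted matrices. *)
Lemma dual_family m n l (F : {linear 'M[R]_(m, n) -> 'M[R]_(m, n)})
    (A : 'I_l -> 'M[R]_(m, n)) :
  (forall c : 'I_l -> R, (forall H, frob (\sum_i c i *: A i) (F H) = 0) ->
     forall i, c i = 0) ->
  exists H : 'I_l -> 'M[R]_(m, n),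
    forall i j, frob (A i) (F (H j)) = (i == j)%:R.
Proof.
move=> indA.
pose E k := F (vec_mx (delta_mx (0 : 'I_1) k)).
pose M := \matrix_(i < l, k < m * n) frob (A i) (E k).
have frobE B H : frob B (F H) = \sum_k mxvec H 0 k * frob B (E k).
  rewrite -{1}(mxvecK H) {1}(row_sum_delta (mxvec H)) !linear_sum frob_sumr.
  by apply: eq_bigr => k _; rewrite !linearZ frobZr.
have /row_freeP[D MD] : row_free M.
  (* Each row of the left kernel is a coefficient vector to which [indA] applies. *)
  rewrite -kermx_eq0; apply/eqP/row_matrixP => a; rewrite row0.
  set u := row a _; have uM : u *m M = 0 by rewrite /u -row_mul mulmx_ker row0.
  apply/rowP => i; rewrite [RHS]mxE; apply: (indA (fun i => u 0 i)) => H.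
  rewrite frobE big1 // => k _; rewrite frob_lincombl.
  have := congr1 (fun Z : 'rV[R]_(m * n) => Z 0 k) uM; rewrite mxE [X in _ = X]mxE.
  under eq_bigr do rewrite [M _ _]mxE.
  by move=> ->; rewrite mulr0.
exists (fun j => vec_mx (col j D)^T) => i j.
rewrite frobE vec_mxK.
have := congr1 (fun Z : 'M[R]_l => Z i j) MD; rewrite mxE [X in _ = X]mxE => <-.
by apply: eq_bigr => k _; rewrite !mxE mulrC.
Qed.

End Frobenius.

(** * Entrywise limits of matrices *)

Section MatrixLimits.
Set Implicit Arguments. Unset Strict Implicit.
Variable R : realType.
Implicit Types m n p : nat.

Lemma norm_mx_leP m n (A : 'M[R]_(m, n)) e : 0 <= e ->
  `|A| <= e <-> forall i j, `|A i j| <= e.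
Proof.
move=> e0; rewrite [`|A|]mx_normrE; split => [/bigmax_leP[_ Ae] i j|Ae].
  exact: (Ae (i, j)).
by apply/bigmax_leP; split => // -[i j] _; exact: Ae.
Qed.

Lemma ler_mx_norm m n (A : 'M[R]_(m, n)) i j : `|A i j| <= `|A|.
Proof. exact: (norm_mx_leP A (normr_ge0 A)).1. Qed.

Lemma cvg_mxP m n (u : nat -> 'M[R]_(m, n)) (L : 'M[R]_(m, n)) :
  u @ \oo --> L <-> forall i j, (u k i j @[k --> \oo] --> L i j).
Proof.
split => [uL i j|uL].
  exact: (cvg_comp _ _ uL (@coord_continuous _ _ _ i j L)).
apply/cvgrPdist_le => e e0; near=> k.
apply/(norm_mx_leP _ (ltW e0)) => i j; rewrite !mxE.
move: i j; near: k.
(* Each entry is eventually close, hence all are at once, the index set being finite. *)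
pose P (ij : 'I_m * 'I_n) (k : nat) := `|L ij.1 ij.2 - u k ij.1 ij.2| <= e.
have : \forall k \near \oo, forall ij, P ij k.
  apply: filter_forall => -[i j]; rewrite /P /=.
  by move/cvgrPdist_le : (uL i j); exact.
by apply: filterS => k Pk i j; exact: (Pk (i, j)).
Unshelve. all: by end_near. Qed.

Lemma cvgn_sum (I : finType) (f : I -> nat -> R) (a : I -> R) :
  (forall i, f i @ \oo --> a i) -> \sum_i f i k @[k --> \oo] --> \sum_i a i.
Proof. by move=> fa; apply: cvg_big => //; exact: add_continuous. Qed.

Lemma cvgn_prod (I : finType) (f : I -> nat -> R) (a : I -> R) :
  (forall i, f i @ \oo --> a i) -> \prod_i f i k @[k --> \oo] --> \prod_i a i.
Proof. by move=> fa; apply: cvg_big => //; exact: mul_continuous. Qed.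

Lemma cvgn_mulmx m n p (u : nat -> 'M[R]_(m, n)) (v : nat -> 'M[R]_(n, p))
    (L : 'M[R]_(m, n)) (M : 'M[R]_(n, p)) :
  u @ \oo --> L -> v @ \oo --> M -> u k *m v k @[k --> \oo] --> L *m M.
Proof.
move=> /cvg_mxP uL /cvg_mxP vM; apply/cvg_mxP => i j; rewrite mxE.
under eq_fun do rewrite mxE.
by apply: cvgn_sum => q; apply: cvgM.
Qed.

Lemma cvgn_det n (u : nat -> 'M[R]_n) (L : 'M[R]_n) :
  u @ \oo --> L -> \det (u k) @[k --> \oo] --> \det L.
Proof.
move=> /cvg_mxP uL; rewrite /determinant; apply: cvgn_sum => s.
by apply: cvgM; [exact: cvg_cst | exact: cvgn_prod].
Qed.

Lemma cvgn_frob m n (A : 'M[R]_(m, n)) (u : nat -> 'M[R]_(m, n)) (L : 'M[R]_(m, n)) :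
  u @ \oo --> L -> frob A (u k) @[k --> \oo] --> frob A L.
Proof.
move=> /cvg_mxP uL; rewrite /frob; apply: cvgn_sum => i; apply: cvgn_sum => j.
by apply: cvgM => //; exact: cvg_cst.
Qed.

End MatrixLimits.

(** * Fixed points of small Lipschitz maps *)

Section FixedPoint.
Set Implicit Arguments. Unset Strict Implicit.
Variables (R : realType) (l : nat).
Implicit Types (f g : 'rV[R]_l -> R) (x y : 'rV[R]_l).

(** One constant bounds both [f] and its variation, so that products stay in the class; every
    polynomial in the coordinates then belongs to it. *)
Definition lip_unit_ball f := exists K, forall x y, `|x| <= 1 -> `|y| <= 1 ->
  `|f x| <= K /\ `|f x - f y| <= K * `|x - y|.

Lemma lip_unit_ball_cst (a : R) : lip_unit_ball (fun=> a).
Proof.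
by exists `|a| => x y _ _; split=> //; rewrite subrr normr0 mulr_ge0.
Qed.

Lemma lip_unit_ball_coord i : lip_unit_ball (fun x => x 0 i).
Proof.
exists 1 => x y x1 y1; split; first exact: le_trans (ler_mx_norm x 0 i) x1.
by rewrite mul1r; have := ler_mx_norm (x - y) 0 i; rewrite !mxE.
Qed.

Lemma lip_unit_ballD f g :
  lip_unit_ball f -> lip_unit_ball g -> lip_unit_ball (fun x => f x + g x).
Proof.
move=> [K fK] [L gL]; exists (K + L) => x y x1 y1.
have [fx fxy] := fK x y x1 y1; have [gx gxy] := gL x y x1 y1; split.
  exact: le_trans (ler_normD _ _) (lerD fx gx).
rewrite opprD addrACA mulrDl; exact: le_trans (ler_normD _ _) (lerD fxy gxy).
Qed.

Lemma lip_unit_ballM f g :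
  lip_unit_ball f -> lip_unit_ball g -> lip_unit_ball (fun x => f x * g x).
Proof.
move=> [K fK] [L gL]; exists (K * L + K * L) => x y x1 y1.
have [fx fxy] := fK x y x1 y1; have [gy _] := gL y x y1 x1.
have [gx gxy] := gL x y x1 y1.
have K0 : 0 <= K by exact: le_trans (normr_ge0 _) fx.
have L0 : 0 <= L by exact: le_trans (normr_ge0 _) gx.
split.
  by rewrite normrM (le_trans (ler_pM _ _ fx gx)) // lerDl mulr_ge0.
have -> : f x * g x - f y * g y = f x * (g x - g y) + (f x - f y) * g y.
  by rewrite mulrBr mulrBl addrA subrK.
rewrite (le_trans (ler_normD _ _)) // !normrM mulrDl lerD //.
  by rewrite -mulrA ler_pM.
by rewrite mulrAC ler_pM.
Qed.

Lemma lip_unit_ball_sum (I : finType) (f : I -> 'rV[R]_l -> R) :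
  (forall i, lip_unit_ball (f i)) -> lip_unit_ball (fun x => \sum_i f i x).
Proof.
move=> fL; elim: (index_enum I) => [|i r IH].
  under eq_fun do rewrite big_nil; exact: lip_unit_ball_cst.
by under eq_fun do rewrite big_cons; exact: lip_unit_ballD.
Qed.

Lemma lip_unit_ball_uniform (phi : 'rV[R]_l -> 'rV[R]_l) :
  (forall i, lip_unit_ball (fun x => phi x 0 i)) ->
  exists2 K, 0 < K & forall x y, `|x| <= 1 -> `|y| <= 1 ->
    `|phi x| <= K /\ `|phi x - phi y| <= K * `|x - y|.
Proof.
move=> /fin_all_exists[K phiK].
have K0 i : 0 <= K i.
  have n1 : `|0 : 'rV[R]_l| <= 1 by rewrite normr0.
  by have [+ _] := phiK i 0 0 n1 n1; exact: le_trans.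
have S0 : 0 <= \sum_i K i by rewrite sumr_ge0.
have KS i : K i <= 1 + \sum_i K i.
  rewrite (bigD1 i) //= addrCA lerDl addr_ge0 ?ler01 // sumr_ge0 //.
(* The summand [1] keeps the constant positive, even for [l = 0]. *)
exists (1 + \sum_i K i); first by rewrite ltr_pwDl.
have S1 : 0 <= 1 + \sum_i K i by rewrite addr_ge0.
move=> x y x1 y1; split.
  apply/(norm_mx_leP _ S1) => i j; rewrite ord1.
  by have [+ _] := phiK j x y x1 y1; move/le_trans; apply.
apply/(norm_mx_leP _ (mulr_ge0 S1 (normr_ge0 _))) => i j; rewrite ord1 !mxE.
have [_ +] := phiK j x y x1 y1; move/le_trans; apply.
by rewrite ler_wpM2r.
Qed.

(** The map [t *: phi] sends the closed unit ball into itself and contracts it with ratio [t * K],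
    at most one half. *)
Lemma small_fixed_point (phi : 'rV[R]_l -> 'rV[R]_l) K : 0 < K ->
  (forall x y, `|x| <= 1 -> `|y| <= 1 ->
    `|phi x| <= K /\ `|phi x - phi y| <= K * `|x - y|) ->
  forall t, 0 < t -> t * K <= 2^-1 ->
  exists2 w, w = t *: phi w & `|w| <= t * K.
Proof.
move=> K0 phiK t t0 tK.
pose B := [set x : 'rV[R]_l | `|x| <= 1].
have tphi x : `|x| <= 1 -> `|t *: phi x| <= t * K.
  move=> x1; rewrite normrZ gtr0_norm // ler_pM2l //.
  by have [] := phiK x x x1 x1.
have fB : set_fun B B (fun x => t *: phi x).
  move=> x /tphi /le_trans; apply; apply: le_trans tK _.
  by rewrite invf_le1 // ler1n.
have clB : closed B.
  rewrite (_ : B = (fun x : 'rV[R]_l => `|x|) @^-1` [set r | r <= 1]) //.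
  by apply: closed_comp; [move=> x _; exact: norm_continuous | exact: closed_le].
have tK0 : 0 <= t * K by rewrite ltW // mulr_gt0.
have ctr : is_contraction (mkfun fB).
  exists (NngNum tK0); split => /=; first by rewrite (le_lt_trans tK) // invf_lt1 // ltr1n.
  move=> [x y] /= [x1 y1]; rewrite -scalerBr normrZ gtr0_norm // -mulrA ler_pM2l //.
  by have [] := phiK x y x1 y1.
have [|w Bw ww] := banach_fixed_point ctr clB.
  by exists 0; rewrite /B /= normr0.
by exists w => //; rewrite ww; exact: tphi.
Qed.

End FixedPoint.

(** * Tangent and normal cones; affine constraints *)

Section Tangents.
Set Implicit Arguments. Unset Strict Implicit.
Variable R : realType.
Variables m n : nat.
Implicit Types (Om : set 'M[R]_(m, n)) (X Y D Xi : 'M[R]_(m, n)).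

(** The step sizes are [d / k.+1]; the free factor [d] allows all of them, the first included, to be
    as small as needed. *)
Lemma bouligand_tangent_seq Om X Xi (d : R) (D : nat -> 'M[R]_(m, n)) :
  0 < d -> D @ \oo --> Xi ->
  (forall k, Om (X + (d / k.+1%:R) *: D k)) -> bouligand_tangent Om X Xi.
Proof.
move=> d0 DXi XOm.
pose t k : R := d / k.+1%:R.
have t0 k : 0 < t k by rewrite divr_gt0.
have tcvg : t @ \oo --> (0 : R).
  rewrite -(mulr0 d); apply: cvgM; [exact: cvg_cst | exact: cvg_harmonic].
exists (fun k => X + t k *: D k), t; split; first exact: XOm.
split.
  rewrite -[X in _ --> X]addr0 -(scale0r Xi).
  by apply: cvgD; [exact: cvg_cst | exact: cvgZ].
split => //; split.
  by move=> a b ab; rewrite /t ler_pM2l // lef_pV2 ?posrE // ler_nat.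
split => //.
rewrite (_ : (fun k => _) = D) //; apply/funext => k.
by rewrite addrC addKr scalerA mulVf ?scale1r // gt_eqF.
Qed.

Lemma bouligand_tangent_ray Om X D :
  (forall t, Om (X + t *: D)) -> bouligand_tangent Om X D.
Proof.
by move=> XOm; apply: (@bouligand_tangent_seq _ _ _ 1 (fun=> D)) => //; exact: cvg_cst.
Qed.

(** Both [D] and [- D] are tangent, and [frob Y] is nonpositive on each. *)
Lemma frechet_normal_line_eq0 Om X Y D : frechet_normal Om X Y ->
  (forall t, Om (X + t *: D)) -> frob Y D = 0.
Proof.
move=> NY XOm; apply/le_anti; rewrite (NY _ (bouligand_tangent_ray XOm)) /=.
rewrite -oppr_le0 -frobNr; apply/NY/bouligand_tangent_ray => t.
by rewrite scalerN -scaleNr.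
Qed.

Lemma bouligand_tangent_sub Om Om' X :
  Om `<=` Om' -> bouligand_tangent Om X `<=` bouligand_tangent Om' X.
Proof.
by move=> sOm Xi [Xs [t [XsOm H]]]; exists Xs, t; split => // k; exact/sOm/XsOm.
Qed.

(** Difference quotients of feasible points are orthogonal to each [A i], and so is their limit. *)
Lemma bouligand_tangent_affine l (A : 'I_l -> 'M[R]_(m, n)) b X Xi :
  affine_set A b X -> bouligand_tangent (affine_set A b) X Xi ->
  forall i, frob (A i) Xi = 0.
Proof.
move=> AX [Xs [t [XsA [_ [_ [_ [_ XsXi]]]]]]] i.
have := cvgn_frob (A := A i) XsXi.
rewrite (_ : (fun k => _) = fun=> 0); last first.
  by apply/funext => k; rewrite frobZr frobBr XsA AX subrr mulr0.
by move=> H0; apply/esym; apply: (cvg_unique _ _ H0) => //; exact: cvg_cst.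
Qed.

(** A tangent to the intersection is tangent to both sets: the affine part vanishes on it, the other
    part is nonpositive. *)
Lemma normal_affine_add_frechet_sub l (A : 'I_l -> 'M[R]_(m, n)) b Om X :
  affine_set A b X ->
  mx_minkowski_sum (normal_affine A) (frechet_normal Om X) `<=`
  frechet_normal (affine_set A b `&` Om) X.
Proof.
move=> AX _ [_ [Y [[y ->] [NY ->]]]] Xi TXi.
rewrite frobDl frob_lincombl big1 ?add0r.
  by apply: NY; apply: bouligand_tangent_sub TXi => Z [].
move=> i _; rewrite (bouligand_tangent_affine AX) ?mulr0 //.
by apply: bouligand_tangent_sub TXi => Z [].
Qed.

End Tangents.

(** * Tangents to the matrices of bounded rank at a full-rank product *)

Section LowRank.
Set Implicit Arguments. Unset Strict Implicit.
Variables (R : realType) (m n s : nat).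
Variables (L0 : 'M[R]_(m, s)) (L1 : 'M[R]_(s, m)).
Variables (R0 : 'M[R]_(s, n)) (R1 : 'M[R]_(n, s)).
Hypotheses (L10 : L1 *m L0 = 1%:M) (R01 : R0 *m R1 = 1%:M).

Let P := 1%:M - L0 *m L1.
Let Q := 1%:M - R1 *m R0.

Let PL0 : P *m L0 = 0.
Proof. by rewrite mulmxBl mul1mx -mulmxA L10 mulmx1 subrr. Qed.

Let R0Q : R0 *m Q = 0.
Proof. by rewrite mulmxBr mulmx1 mulmxA R01 mul1mx subrr. Qed.

(** This is [H - P H Q], a projection onto the matrices [L0 G + C R0], composed from linear maps so
    that its linearity is inferred. *)
Definition rank_tangent : 'M[R]_(m, n) -> 'M[R]_(m, n) :=
  mulmx (L0 *m L1) \+ (mulmxr (R1 *m R0) \o mulmx (1%:M - L0 *m L1)).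

HB.instance Definition _ := GRing.Linear.on rank_tangent.

Lemma rank_tangentE H :
  rank_tangent H = L0 *m (L1 *m H) + (P *m H *m R1) *m R0.
Proof. by rewrite /rank_tangent /= !mulmxA. Qed.

Lemma rank_tangent_mull G : rank_tangent (L0 *m G) = L0 *m G.
Proof.
by rewrite rank_tangentE !mulmxA PL0 !mul0mx addr0 -(mulmxA L0 L1) L10 mulmx1.
Qed.

Lemma rank_tangent_mulr C : rank_tangent (C *m R0) = C *m R0.
Proof.
rewrite rank_tangentE !mulmxA -(mulmxA _ R0 R1) R01 mulmx1 -mulmxDl.
by rewrite mulmxBl mul1mx addrC subrK.
Qed.

(** [rank_tangent] fixes every [L0 G] and every [C R0], so [A] is orthogonal to all of them. *)
Lemma frob_rank_tangent_eq0 A : (forall H, frob A (rank_tangent H) = 0) ->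
  L0^T *m A = 0 /\ A *m R0^T = 0.
Proof.
move=> A0; split; apply: frob_eq0 => G.
  by rewrite -frob_mulmxl -rank_tangent_mull.
by rewrite -frob_mulmxr -rank_tangent_mulr.
Qed.

(* Bordering [L1 Xs R1] by a row [u / t] with [u L0 = 0] and a column [v] with
   [R0 v = 0] gives singular matrices, and the determinant of their limit is
   [u Xi v]. *)
Lemma bouligand_tangent_low_rank Xi :
  bouligand_tangent (low_rank m n s) (L0 *m R0) Xi -> rank_tangent Xi = Xi.
Proof.
move=> [Xs [t [Xr [XsX [t0 [_ [_ XsXi]]]]]]].
(* [Xi] and [rank_tangent Xi] differ by [P Xi Q]. *)
suff PXQ : P *m Xi *m Q = 0.
  rewrite rank_tangentE -[LHS]addr0 -PXQ /Q mulmxBr mulmx1 !mulmxA -addrA.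
  by rewrite [X in _ + X]addrC subrK mulmxBl mul1mx addrC subrK.
apply/matrixP => i j; rewrite [RHS]mxE.
pose u := row i P; pose v := col j Q.
have uX : u *m (L0 *m R0) = 0 by rewrite mulmxA /u -row_mul PL0 row0 mul0mx.
have R0v : R0 *m v = 0 by rewrite /v colE mulmxA R0Q mul0mx.
have -> : (P *m Xi *m Q) i j = \det (u *m Xi *m v).
  by rewrite det_mx11 /u /v colE mulmxA -!row_mul -colE [RHS]mxE [RHS]mxE.
(* The last row of the bordered matrix is taken from [W]: both arguments converge, although [u / t]
   need not. *)
pose N (Z W : 'M[R]_(m, n)) := col_mx L1 0 *m Z *m row_mx R1 v
                             + col_mx 0 u *m W *m row_mx R1 v.
pose Xi_ k := (t k)^-1 *: (Xs k - L0 *m R0).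
have detN k : \det (N (Xs k) (Xi_ k)) = 0.
  (* Since [u] annihilates [L0 R0], the row [u Xi_ k] is [u Xs k / t k]. *)
  have -> : N (Xs k) (Xi_ k) = col_mx L1 ((t k)^-1 *: u) *m Xs k *m row_mx R1 v.
    rewrite /N /Xi_ -mulmxDl; congr (_ *m _).
    rewrite !mul_col_mx !mul0mx add_col_mx addr0 add0r.
    by rewrite -scalemxAr mulmxBr uX subr0 -scalemxAl.
  (* The matrix has size [s + 1] and, like [Xs k], rank at most [s]. *)
  apply/eqP; rewrite -[_ == 0]negbK -unitfE -unitmxE -row_free_unit -row_leq_rank.
  rewrite -ltnNge; apply: (@leq_ltn_trans s); last by rewrite addn1.
  apply: leq_trans (mxrankM_maxl _ _) _.
  exact: leq_trans (mxrankM_maxr _ _) (Xr k).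
have cvgN : N (Xs k) (Xi_ k) @[k --> \oo] --> N (L0 *m R0) Xi.
  by apply: cvgD; apply: cvgn_mulmx (cvg_cst _); apply: cvgn_mulmx => //; exact: cvg_cst.
have := cvgn_det cvgN; under eq_fun do rewrite detN.
move=> /(cvg_unique (@norm_hausdorff _ _)) /(_ (cvg_cst _)).
have -> : N (L0 *m R0) Xi = block_mx 1%:M 0 (u *m Xi *m R1) (u *m Xi *m v).
  rewrite /N !mul_col_mx !mul0mx !mul_mx_row add_col_mx addr0 add0r.
  by rewrite (mulmxA L1 L0) L10 mul1mx R01 R0v.
by rewrite det_lblock det1 mul1r.
Qed.

Lemma bouligand_tangent_affine_low_rank l (A : 'I_l -> 'M[R]_(m, n)) b
    (B : 'I_l -> 'M[R]_(m, n)) H :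
  affine_set A b (L0 *m R0) ->
  (forall i j, frob (A i) (rank_tangent (B j)) = (i == j)%:R) ->
  (forall i, frob (A i) (rank_tangent H) = 0) ->
  bouligand_tangent (affine_set A b `&` low_rank m n s) (L0 *m R0)
    (rank_tangent H).
Proof.
move=> AX AB AH.
(* By duality and [AH], the value of [frob (A i)] on [rank_tangent (Hc w)] is the coordinate
   [w 0 i]. *)
pose Hc (w : 'rV[R]_l) := H + \sum_j w 0 j *: B j.
(* [q] is the second-order term of the curve; feasibility at time [t] reads [w = t *: phi w]. *)
pose q (Z : 'M[R]_(m, n)) := (P *m Z *m R1) *m (L1 *m Z).
pose phi w : 'rV[R]_l := \row_i - frob (A i) (q (Hc w)).
(* The entries of [phi w] are polynomials in [w], which yields the Lipschitz bounds. *)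
have lip_mulmx a c d (f : 'rV[R]_l -> 'M[R]_(a, c)) (g : 'rV[R]_l -> 'M[R]_(c, d)) :
    (forall i j, lip_unit_ball (fun w => f w i j)) ->
    (forall i j, lip_unit_ball (fun w => g w i j)) ->
    forall i j, lip_unit_ball (fun w => (f w *m g w) i j).
  move=> fL gL i j; under eq_fun do rewrite mxE.
  by apply: lip_unit_ball_sum => k; exact: lip_unit_ballM.
have lip_Hc i j : lip_unit_ball (fun w => Hc w i j).
  under eq_fun do rewrite mxE summxE.
  apply: lip_unit_ballD; first exact: lip_unit_ball_cst.
  apply: lip_unit_ball_sum => k; under eq_fun do rewrite mxE.
  apply: lip_unit_ballM; [exact: lip_unit_ball_coord|exact: lip_unit_ball_cst].
have lip_phi i : lip_unit_ball (fun w => phi w 0 i).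
  under eq_fun do rewrite mxE -mulN1r.
  apply: lip_unit_ballM; first exact: lip_unit_ball_cst.
  apply: lip_unit_ball_sum => a; apply: lip_unit_ball_sum => c.
  apply: lip_unit_ballM; first exact: lip_unit_ball_cst.
  apply: (@lip_mulmx _ _ _) => {}a {}c; apply: (@lip_mulmx _ _ _) => {}a {}c //;
    do ?exact: lip_unit_ball_cst.
  by apply: (@lip_mulmx _ _ _) => {}a {}c //; exact: lip_unit_ball_cst.
have [K K0 phiK] := lip_unit_ball_uniform lip_phi.
(* This [d] gives [t k * K <= 2^-1] from [k = 0] on, as the fixed point requires. *)
pose d := (2 * K)^-1; have d0 : 0 < d by rewrite invr_gt0 mulr_gt0.
pose t k : R := d / k.+1%:R.
have t0 k : 0 < t k by rewrite divr_gt0.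
have tK k : t k * K <= 2^-1.
  rewrite /t /d invfM mulrAC divfK ?gt_eqF // ler_pdivrMr // ler_peMr //.
  by rewrite ler1n.
have /choice[w wP] k : exists w, w = t k *: phi w /\ `|w| <= t k * K.
  by have [w] := small_fixed_point K0 phiK (t0 k) (tK k); exists w.
have tcvg : t @ \oo --> (0 : R).
  by rewrite -(mulr0 d); apply: cvgM; [exact: cvg_cst | exact: cvg_harmonic].
have wcvg : w @ \oo --> (0 : 'rV[R]_l).
  apply: norm_cvg0; apply: (@squeeze_cvgr _ _ _ _ (fun=> 0) (fun k => t k * K)).
  - by apply: nearW => k; rewrite normr_ge0 (wP k).2.
  - exact: cvg_cst.
  - by rewrite -(mul0r K); apply: cvgM => //; exact: cvg_cst.
have Hcvg : Hc (w k) @[k --> \oo] --> H.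
  apply/cvg_mxP => i j.
  have -> : H i j = H i j + \sum_c 0 * B c i j.
    by rewrite big1 ?addr0 // => c _; rewrite mul0r.
  under eq_fun do rewrite mxE summxE.
  apply: cvgD; [exact: cvg_cst | apply: cvgn_sum => c].
  under eq_fun do rewrite mxE.
  apply: cvgM; last exact: cvg_cst.
  by move/cvg_mxP : wcvg => /(_ 0 c); rewrite mxE.
(* The exact difference quotient of the curve at [t k], quadratic term included. *)
pose D k := rank_tangent (Hc (w k)) + t k *: q (Hc (w k)).
apply: (@bouligand_tangent_seq _ _ _ _ _ _ d D) => //.
  rewrite -[X in _ --> X]addr0 -(scale0r (q H)).
  apply: cvgD; last apply: cvgZ => //.
    rewrite rank_tangentE; under eq_fun do rewrite rank_tangentE.
    apply: cvgD.
      by apply: cvgn_mulmx; [|apply: cvgn_mulmx] => //; exact: cvg_cst.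
    do 2!(apply: cvgn_mulmx (cvg_cst _)).
    by apply: cvgn_mulmx => //; exact: cvg_cst.
  apply: cvgn_mulmx.
    by apply: cvgn_mulmx (cvg_cst _); apply: cvgn_mulmx => //; exact: cvg_cst.
  by apply: cvgn_mulmx => //; exact: cvg_cst.
move=> k; rewrite -/(t k); split.
  move=> i; rewrite frobDr AX frobZr frobDr frobZr /Hc linearD linear_sum.
  rewrite frobDr AH add0r frob_sumr.
  under eq_bigr do rewrite linearZ frobZr AB.
  rewrite (bigD1 i) //= eqxx mulr1 big1 ?addr0; last first.
    by move=> j ji; rewrite eq_sym (negbTE ji) mulr0.
  (* The fixed point equation cancels [w k] against the quadratic term. *)
  by rewrite {1}(wP k).1 !mxE -/(Hc (w k)) mulrN addNr mulr0 addr0.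
(* A product of inner dimension [s] has rank at most [s]. *)
have -> : L0 *m R0 + t k *: D k = (L0 + t k *: (P *m Hc (w k) *m R1)) *m
                                  (R0 + t k *: (L1 *m Hc (w k))).
  rewrite /D /q rank_tangentE.
  move: (P *m Hc (w k) *m R1) (L1 *m Hc (w k)) => C G.
  by rewrite mulmxDl !mulmxDr -!scalemxAl -!scalemxAr !scalerDr !addrA.
exact: leq_trans (mxrankM_maxl _ _) (rank_leq_col _).
Qed.

End LowRank.

(** * The independence assumptions freed of the singular vectors *)

Section SVD.
Set Implicit Arguments. Unset Strict Implicit.
Variables (R : realType) (m n s : nat).
Variables (X : 'M[R]_(m, n)) (U : 'M[R]_m) (S : 'M[R]_(m, n)) (V : 'M[R]_n).
Hypothesis svdX : is_svd X s U S V.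

(** [S^T U^T A V = V^T X^T A V = 0], and its row [i] is the positive [i]-th singular value times row
    [i] of [U^T A V]. *)
Lemma svd_rows_eq0 (A : 'M[R]_(m, n)) : (s <= n)%N -> X^T *m A = 0 ->
  forall (i : 'I_m) (j : 'I_n), (i < s)%N -> (U^T *m A *m V) i j = 0.
Proof.
case: svdX => [oU oV [S0 Spos _ _] XE] sn XA i j is_.
have : S^T *m (U^T *m A *m V) = 0.
  have -> : S^T *m (U^T *m A *m V) = V^T *m (X^T *m A) *m V.
    by rewrite XE !trmx_mul trmxK !mulmxA oV mul1mx.
  by rewrite XA mulmx0 mul0mx.
pose k := Ordinal (leq_trans is_ sn).
move/matrixP => /(_ k j); rewrite mxE (bigD1 i) //= big1 ?addr0.
  rewrite [S^T _ _]mxE [RHS]mxE => /eqP; rewrite mulf_eq0.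
  by rewrite gt_eqF ?Spos //= => /eqP.
move=> a ai; rewrite [S^T _ _]mxE S0 ?mul0r //= => ak.
by case/eqP: ai; apply/val_inj.
Qed.

(** Right multiplication by [S^T] scales column [j] by the positive [j]-th singular value. *)
Lemma svd_cols_eq0 (A : 'M[R]_(m, n)) : (s <= m)%N -> A *m X^T = 0 ->
  forall (i : 'I_m) (j : 'I_n), (j < s)%N -> (U^T *m A *m V) i j = 0.
Proof.
case: svdX => [oU oV [S0 Spos _ _] XE] sm XA i j js.
have : U^T *m A *m V *m S^T = 0.
  have -> : U^T *m A *m V *m S^T = U^T *m (A *m X^T) *m U.
    by rewrite XE !trmx_mul trmxK -!mulmxA oU mulmx1.
  by rewrite XA mulmx0 mul0mx.
pose k := Ordinal (leq_trans js sm).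
move/matrixP => /(_ i k); rewrite mxE (bigD1 j) //= big1 ?addr0.
  rewrite [S^T _ _]mxE [RHS]mxE => /eqP; rewrite mulf_eq0.
  by rewrite orbC gt_eqF ?Spos //= => /eqP.
move=> a aj; rewrite [S^T _ _]mxE S0 ?mulr0 //= => ka.
by case/eqP: aj; apply/val_inj.
Qed.

(** [T_mx] keeps exactly the entries in the first [s] rows or columns, where [U^T A V] vanishes for
    the combination. *)
Lemma T_mx_lincomb_eq0 l (A : 'I_l -> 'M[R]_(m, n)) (c : 'I_l -> R) :
  (s <= m)%N -> (s <= n)%N ->
  X^T *m (\sum_i c i *: A i) = 0 -> (\sum_i c i *: A i) *m X^T = 0 ->
  \sum_i c i *: T_mx s U V (A i) = 0.
Proof.
move=> sm sn XA AX; apply/matrixP => i j; rewrite [RHS]mxE summxE.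
under eq_bigr do rewrite 2!mxE.
have [ij|_] := boolP ((i < s)%N || (j < s)%N); last first.
  by rewrite big1 // => k _; rewrite mulr0.
have UAV : (U^T *m (\sum_i c i *: A i) *m V) i j = 0.
  by case/orP : ij => [ls|js]; [exact: svd_rows_eq0 | exact: svd_cols_eq0].
rewrite -[RHS]UAV mulmx_sumr mulmx_suml summxE; apply: eq_bigr => k _.
by rewrite -scalemxAr -scalemxAl [RHS]mxE.
Qed.

Lemma R_mx_lincomb_eq0 l (A : 'I_l -> 'M[R]_(m, n)) (c : 'I_l -> R)
    (sn : (s <= n)%N) :
  (s <= m)%N -> (\sum_i c i *: A i) *m X^T = 0 ->
  \sum_i c i *: R_mx sn U V (A i) = 0.
Proof.
move=> sm AX; apply/matrixP => i j; rewrite [RHS]mxE summxE.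
under eq_bigr do rewrite 2!mxE.
have UAV := svd_cols_eq0 sm AX i (ltn_ord j : (widen_ord sn j < s)%N).
rewrite -[RHS]UAV mulmx_sumr mulmx_suml summxE; apply: eq_bigr => k _.
by rewrite -scalemxAr -scalemxAl [RHS]mxE.
Qed.

End SVD.

(** * Normal cones of the intersection *)

Section Normals.
Set Implicit Arguments. Unset Strict Implicit.
Variables (R : realType) (m n l : nat) (A : 'I_l -> 'M[R]_(m, n)) (b : 'I_l -> R).
Variable X : 'M[R]_(m, n).
Hypothesis AX : affine_set A b X.

Let L0 := col_base X.
Let R0 := row_base X.
Let L1 := pinvmx L0.
Let R1 := pinvmx R0.

Let XE : X = L0 *m R0. Proof. exact/esym/mulmx_base. Qed.
Let L10 : L1 *m L0 = 1%:M. Proof. exact/mulVpmx/col_base_full. Qed.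
Let R01 : R0 *m R1 = 1%:M. Proof. exact/mulmxVp/row_base_free. Qed.

(** The hypothesis is Assumption 1 in intrinsic form: no nontrivial combination of the [A i] is
    orthogonal to the tangent space of the rank variety. *)
Lemma frechet_normal_affine_low_rank :
  (forall c : 'I_l -> R, X^T *m (\sum_i c i *: A i) = 0 ->
     (\sum_i c i *: A i) *m X^T = 0 -> forall i, c i = 0) ->
  frechet_normal (affine_set A b `&` low_rank m n (\rank X)) X =
  mx_minkowski_sum (normal_affine A) (frechet_normal (low_rank m n (\rank X)) X).
Proof.
move=> indA; apply/seteqP; split; last exact: normal_affine_add_frechet_sub.
pose T : {linear _ -> _} := rank_tangent L0 L1 R0 R1.
have [c Ac0|B AB] := @dual_family _ _ _ _ T A.
  have [LA AR] := frob_rank_tangent_eq0 L10 R01 Ac0.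
  by apply: indA; rewrite XE trmx_mul -?mulmxA ?LA ?mulmx0 // mulmxA AR mul0mx.
(* With these coefficients [Y - \sum_i y i *: A i] vanishes on every [T (B j)]. *)
move=> Y NY; pose y i := frob Y (T (B i)).
have tgt H : (forall i, frob (A i) (T H) = 0) -> frob Y (T H) <= 0.
  move=> AH; apply: NY; rewrite {2}XE.
  by apply: (bouligand_tangent_affine_low_rank _ AB AH); rewrite -XE.
have YT H : frob (Y - \sum_i y i *: A i) (T H) = 0.
  (* The correction puts [T H'] in the kernel of the constraints, where [tgt] applies to both [H']
     and [- H']. *)
  pose H' := H - \sum_i frob (A i) (T H) *: B i.
  have TH' Z : frob Z (T H') = frob Z (T H) - \sum_i frob (A i) (T H) * frob Z (T (B i)).
    rewrite linearB linear_sum frobBr frob_sumr; congr (_ - _).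
    by apply: eq_bigr => i _; rewrite linearZ frobZr.
  have AH' i : frob (A i) (T H') = 0.
    rewrite TH' (bigD1 i) //= AB eqxx mulr1 big1 ?addr0 ?subrr //.
    by move=> j ji; rewrite AB eq_sym (negbTE ji) mulr0.
  have : frob Y (T H') = 0.
    apply/le_anti; rewrite tgt //= -oppr_le0 -frobNr -linearN tgt // => i.
    by rewrite linearN frobNr AH' oppr0.
  rewrite TH' frobBl frob_lincombl => YH'; rewrite -[RHS]YH'; congr (_ - _).
  by apply: eq_bigr => i _; rewrite mulrC.
exists (\sum_i y i *: A i), (Y - \sum_i y i *: A i); split; first by exists y.
split; last by rewrite addrC subrK.
(* A tangent to the rank variety is fixed by [T], hence in its range. *)
move=> Xi; rewrite {2}XE => /(bouligand_tangent_low_rank L10 R01) <-.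
by rewrite [leLHS]YT.
Qed.

Lemma frechet_normal_affine_low_rank_deficient r : (\rank X < r)%N ->
  (forall c : 'I_l -> R, (\sum_i c i *: A i) *m X^T = 0 -> forall i, c i = 0) ->
  frechet_normal (affine_set A b `&` low_rank m n r) X `<=` normal_affine A.
Proof.
move=> sr indA.
(* The values of [T] have the form [C R0]; adding one to [X] keeps the factor [R0] and so does not
   raise the rank. *)
pose T : {linear _ -> _} := @mulmxr R m _ _ (R1 *m R0).
have [c Ac0|B AB] := @dual_family _ _ _ _ T A.
  apply: indA; rewrite XE trmx_mul mulmxA.
  suff -> : (\sum_i c i *: A i) *m R0^T = 0 by rewrite mul0mx.
  apply: frob_eq0 => C; rewrite -frob_mulmxr -(Ac0 (C *m R0)) /=.
  by rewrite -(mulmxA C) (mulmxA R0) R01 mul1mx.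
move=> Y NY; exists (fun i => frob Y (T (B i))); apply/matrixP => a c.
pose E := delta_mx a c : 'M[R]_(m, n).
(* The rank-one [E] is corrected within the range of [T] to be orthogonal to every [A i]. *)
pose D := E - \sum_i frob (A i) E *: T (B i).
have : frob Y D = 0.
  apply: (frechet_normal_line_eq0 NY) => t; split.
    move=> i; rewrite frobDr AX frobZr frobBr frob_lincombr (bigD1 i) //=.
    rewrite AB eqxx mulr1 big1 ?addr0 ?subrr ?mulr0 ?addr0 // => j ji.
    by rewrite AB eq_sym (negbTE ji) mulr0.
  have -> : X + t *: D = (L0 - t *: \sum_i frob (A i) E *: (B i *m R1)) *m R0
                         + t *: E.
    rewrite mulmxBl -XE -scalemxAl mulmx_suml /D scalerBr -addrA; congr (_ + _).
    rewrite addrC; congr (_ - _ *: _); apply: eq_bigr => i _.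
    by rewrite -scalemxAl /= mulmxA.
  (* The first summand has rank at most that of [X], which leaves room for the rank one of [E]. *)
  apply: leq_trans (mxrank_add _ _) (leq_trans _ sr); rewrite -addn1 leq_add //.
    exact: leq_trans (mxrankM_maxl _ _) (rank_leq_col _).
  by rewrite (leq_trans (mxrank_scale _ _)) // mxrank_delta.
(* Pairing with [E] extracts the entry at [a], [c], so [frob Y D = 0] gives [Y a c] in terms of the
   [A i]. *)
rewrite frobBr frob_lincombr [frob Y E]frob_delta => /subr0_eq ->.
rewrite summxE; apply: eq_bigr => i _.
by rewrite [frob (A i) E]frob_delta mxE mulrC.
Qed.

End Normals.

(** * Assembly of the full-rank and the rank-deficient case *)

Theorem theorem3p1 (R : realType) (m n r l : nat)
  (A : 'I_l -> 'M[R]_(m, n)) (b : 'I_l -> R) (X : 'M[R]_(m, n))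
  (s : nat) (U : 'M[R]_m) (S : 'M[R]_(m, n)) (V : 'M[R]_n)
  (hmn : (n <= m)%N) (hr : (r < n)%N)
  (hXL : affine_set A b X) (hXM : low_rank m n r X)
  (hs : \rank X = s) (hsvd : is_svd X s U S V) :
  ((s = r -> lin_indep (fun i => T_mx s U V (A i)) ->
     frechet_normal (affine_set A b `&` low_rank m n r) X =
     mx_minkowski_sum (normal_affine A) (frechet_normal (low_rank m n r) X))
  /\
  (forall hsn : (s <= n)%N, (s < r)%N ->
     lin_indep (fun i => R_mx hsn U V (A i)) ->
     frechet_normal (affine_set A b `&` low_rank m n r) X =
       mx_minkowski_sum (normal_affine A) (frechet_normal (low_rank m n r) X) /\
     mx_minkowski_sum (normal_affine A) (frechet_normal (low_rank m n r) X) =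
       normal_affine A)).
Proof.
have sm : (s <= m)%N by rewrite -hs rank_leq_row.
have sn : (s <= n)%N by rewrite -hs rank_leq_col.
split=> [sr indT|hsn sr indR].
  rewrite -sr -hs; apply: frechet_normal_affine_low_rank => // c XA AX.
  exact/indT/(T_mx_lincomb_eq0 hsvd).
(* A cycle of three inclusions gives both equalities: normals of the intersection in
   [normal_affine A], that set in the sum, the sum back in the normals. *)
have sub : frechet_normal (affine_set A b `&` low_rank m n r) X `<=`
           normal_affine A.
  apply: frechet_normal_affine_low_rank_deficient => //; first by rewrite hs.
  by move=> c AX; exact/indR/(R_mx_lincomb_eq0 hsvd).
have sup := @normal_affine_add_frechet_sub R m n l A b (low_rank m n r) X hXL.
have sub0 : normal_affine A `<=`
    mx_minkowski_sum (normal_affine A) (frechet_normal (low_rank m n r) X).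
  move=> Y AY; exists Y, 0; split=> //; split; last by rewrite addr0.
  by move=> Xi _; rewrite frobC frob0r.
split; apply/seteqP; split=> //.
- exact: subset_trans sub sub0.
- exact: subset_trans sup sub.
Qed.
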